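(* Let $f:S\to S$ be a generalized pseudo-Anosov homeomorphism. For any primitive Markov partition $\mathcal{R}(z,n)$, where $n\ge n(f)$ and $z$ is a first intersection point of $f$, the following equality holds for all $m\in\mathbb{Z}$: $$T(\mathcal{R}(z,n))=T(\mathcal{R}(f^m(z),n)),$$ where $\mathcal{R}(z,n)$ carries any labeling and choice of vertical directions making it a geometric Markov partition, and $\mathcal{R}(f^m(z),n)=f^m(\mathcal{R}(z,n))$ carries the labeling and vertical directions induced by $f^m$.
   Context: **Pseudo-Anosov maps.** A surface $S$ is a smooth closed oriented 2-manifold. A generalized pseudo-Anosov homeomorphism $f:S\to S$ is an orientation-preserving homeomorphism for which there are $\lambda>1$ and two $f$-invariant transverse measured singular foliations $(\mathcal{F}^s,\mu^s)$ (stable) and $(\mathcal{F}^u,\mu^u)$ (unstable), possibly with 1-prong singularities (spines), with $f_*\mu^s=\lambda\mu^s$, $f_*\mu^u=\lambda^{-1}\mu^u$; the convention is that $f$ stretches unstable arcs (measured by $\mu^s$) by $\lambda$ and contracts stable arcs (measured by $\mu^u$) by $\lambda^{-1}$. $\mathbf{Sing}(f)$ is the set of singularities of the foliations; if there are none (torus case), $\mathbf{Sing}(f)$ denotes a fixed nonempty finite $f$-invariant family of periodic points. $\mathcal{F}^{s}(p),\mathcal{F}^u(p)$ (also $F^s_p$, $F^u_p$) are the leaves through $p$ (for a singularity, including all its prongs); $\mathcal{F}^{s,u}(\mathbf{Sing}(f))$ is the union of these over $p\in\mathbf{Sing}(f)$. A stable (unstable) separatrix $F^s(p)$ ($F^u(p)$)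 of $p\in\mathbf{Sing}(f)$ is a connected component of $\mathcal{F}^s(p)\setminus\{p\}$ ($\mathcal{F}^u(p)\setminus\{p\}$); for $x$ on it, $[p,x]^s$ ($[p,x]^u$) is the arc from $p$ to $x$ in the leaf. A stable (unstable) interval is an arc in a stable (unstable) leaf. **First intersection points.** A point $x\notin\mathbf{Sing}(f)$ is a first intersection point of $f$ if there are $p,q\in\mathbf{Sing}(f)$, a stable separatrix $F^s(p)$ and an unstable separatrix $F^u(q)$ with $x\in F^s(p)\cap F^u(q)$ and $(p,x]^s\cap(q,x]^u=\{x\}$. **Rectangles.** For an open connected nonempty $r\subset S$ and $x\in r$, let $I_x$ (resp. $J_x$) be the closure of the connected component of $F^s_x\cap r$ (resp. $F^u_x\cap r$) containing $x$. The set $r$ is trivially bi-foliated if for all $x,y\in r$, $I_x$ and $J_y$ are homeomorphic to closed intervals and $I_x\cap J_y$ is a single point, lying in $r$. A rectangle $R$ is the closure of a trivially bi-foliated set. A parametrization of $R$ is a continuous map $\rho:[0,1]^2\to S$ with image $R$, restricting to an orientation-preserving homeomorphism from $(0,1)^2$ onto the interior $\overset{o}{R}:=\rho((0,1)^2)$, mapping each horizontal (vertical) segment homeomorphically onto an arc of a single stable (unstable) leaf, called a horizontal (vertical) leaf of $R$. $\partial^sR=\rho([0,1]\times\{0,1\})$, $\partial^uR=\rho(\{0,1\}\times[0,1])$; the two arcs of $\partial^uR$ are the $u$-boundary components. $R$ is embedded if $\rho$ is a homeomorphism onto its image. A rectangle $H\subset R$ is a horizontal (vertical) subrectangle if for every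 $x\in\overset{o}{H}$ the component of $\overset{o}{H}\cap F^s_x$ ($\overset{o}{H}\cap F^u_x$) containing $x$ equals that of $\overset{o}{R}\cap F^s_x$ ($\overset{o}{R}\cap F^u_x$). **Markov partitions.** A Markov partition for $f$ is a finite labeled family of rectangles $\mathcal{R}=\{R_i\}_{i=1}^N$ with $S=\bigcup R_i$, pairwise disjoint interiors $\overset{o}{R_i}$, and such that for all $i,j$ the closure of each nonempty component of $\overset{o}{R_i}\cap f^{-1}(\overset{o}{R_j})$ is a horizontal subrectangle of $R_i$ and the closure of each nonempty component of $f(\overset{o}{R_i})\cap\overset{o}{R_j}$ is a vertical subrectangle of $R_j$. **Geometric type.** A vertical direction on a rectangle is an orientation of its vertical leaves induced via a parametrization by one of the two orientations $\xi_v$ of the vertical lines of $[0,1]^2$; it determines the horizontal direction, induced by the orientation $\xi_h$ such that $(\xi_v,\xi_h)$ is the standard orientation of $\mathbb{R}^2$. A geometric rectangle is a rectangle with a chosen vertical direction; a geometric Markov partition is a Markov partition of geometric rectangles. Horizontal subrectangles of $(f,\mathcal{R})$ in $R_i$ are the closures of the components of $\overset{o}{R_i}\cap\bigcup_jf^{-1}(\overset{o}{R_j})$, labeled $H^i_1,\dots,H^i_{h_i}$ from bottom to top along the vertical direction of $R_i$; vertical subrectangles in $R_k$ are the closures of the components of $\overset{o}{R_k}\cap\bigcup_if(\overset{o}{R_i})$, labeled $V^k_1,\dots,V^k_{v_k}$ from left to right along the horizontal direction of $R_k$. Subrectangles inherit the directions of the ambient rectangle. Define $\rho(i,j)=(k,l)$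 iff $f(H^i_j)=V^k_l$, and $\epsilon(i,j)=1$ if $f$ maps the vertical direction of $H^i_j$ to that of $V^k_l=f(H^i_j)$, $-1$ otherwise. The geometric type is $T(\mathcal{R})=T(f,\mathcal{R})=(N,\{(h_i,v_i)\}_{i=1}^N,\rho,\epsilon)$. The geometric partition induced by an orientation-preserving homeomorphism $h$ is $h(\mathcal{R})=\{h(R_i)\}_{i=1}^N$ with $h(R_i)$ oriented so that $h$ preserves both the vertical and horizontal directions. **Adapted graphs.** An $s$-graph adapted to $f$ is a finite family $\delta^s=\{I_i\}$ of nondegenerate compact stable intervals such that, with $\cup\delta^s:=\bigcup_iI_i$: $f(\cup\delta^s)\subset\cup\delta^s$; each $I_i$ lies in $\mathcal{F}^s(p)$ for some $p\in\mathbf{Sing}(f)$; for every $p\in\mathbf{Sing}(f)$ and every stable separatrix of $p$ some $I_i$ lies in that separatrix (together with $p$) and has $p$ as an endpoint; endpoints of each $I_i$ lie in $\mathcal{F}^u(\mathbf{Sing}(f))$. A $u$-graph adapted to $f$ is defined exchanging $s,u$ and $f,f^{-1}$. **Rails and compatibility.** The regular part $\overset{o}{\delta^s}$ is $\cup\delta^s$ minus all endpoints of its intervals. A regular $u$-rail of $\delta^s$ is an unstable interval with interior disjoint from $\cup\delta^s$ and endpoints in $\overset{o}{\delta^s}$. An extreme $u$-rail of $\delta^s$ is an unstable segment $J$ with at least one endpoint not in $\overset{o}{\delta^s}$ for which there is an embedded rectangle $R$ with $\partial^sR\subset\cup\delta^s$, $J$ a $u$-boundary component of $R$, and every other vertical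 leaf of $R$ a regular $u$-rail. $s$-rails of $\delta^u$ are defined by exchanging $s$ and $u$. $\delta^s$ and $\delta^u$ are compatible if endpoints of intervals of $\delta^s$ lie in $\cup\delta^u$, endpoints of intervals of $\delta^u$ lie in $\cup\delta^s$, extreme $u$-rails of $\delta^s$ are contained in $\cup\delta^u$, and extreme $s$-rails of $\delta^u$ are contained in $\cup\delta^s$. **Primitive partitions.** Let $z\in F^s(p)\cap F^u(q)$ be a first intersection point. Put $J^u(z)=[q,z]^u$ and $\mathcal{J}^u(z)=\bigcup_{i\ge0}f^{-i}(J^u(z))$, a finite union of compact arcs, $f^{-1}$-invariant. Let $\delta^s(z)$ be the family of all stable segments with one endpoint in $\mathbf{Sing}(f)$, the other in $\mathcal{J}^u(z)$, and interior disjoint from $\mathcal{J}^u(z)$; it is an $s$-graph adapted to $f$. Let $\delta^u(z)$ be the family of all unstable segments with one endpoint in $\mathbf{Sing}(f)$, the other in $\cup\delta^s(z)$, and interior disjoint from $\cup\delta^s(z)$; it is a $u$-graph adapted to $f$. The compatibility coefficient $n(z)$ is the least natural number such that $\delta^s(z)$ and $f^n(\delta^u(z))$ are compatible for all $n\ge n(z)$. For $n\ge n(z)$, the primitive Markov partition $\mathcal{R}(z,n)$ generated by $z$ of order $n$ is the family of closures of the connected components of $S\setminus(\cup\delta^s(z)\cup\bigcup f^n(\delta^u(z)))$; it is a Markov partition for $f$. The compatibility order is $n(f)=\max\{n(z):z\text{ a first intersection point of }f\}$ (the maximum exists). *)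

(* Defs.v *)
From HB Require Import structures.
From mathcomp Require Import all_boot all_order all_algebra.
From mathcomp Require Import all_classical all_reals all_analysis.
From mathcomp Require Import complex.
Set Implicit Arguments. Unset Strict Implicit. Unset Printing Implicit Defensive.
Import Order.TTheory GRing.Theory Num.Theory numFieldNormedType.Exports.
Local Open Scope classical_set_scope.
Local Open Scope ring_scope.

Section Plane.
Variable R : realType.
Implicit Types (g : R * R -> R) (V : set (R * R)) (x c : R * R).

Definition d1 g x : R := derive1 (fun t : R => g (t, x.2)) x.1.
Definition d2 g x : R := derive1 (fun t : R => g (x.1, t)) x.2.

Fixpoint Ck (k : nat) V g : Prop :=
  {within V, continuous g} /\
  if k is k'.+1 then
    [/\ forall x, V x -> derivable (fun t : R => g (t, x.2)) x.1 1 /\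
                         derivable (fun t : R => g (x.1, t)) x.2 1,
        Ck k' V (d1 g) & Ck k' V (d2 g)]
  else True.

Definition smooth_map V (g : R * R -> R * R) :=
  forall k, Ck k V (fun x => (g x).1) /\ Ck k V (fun x => (g x).2).

Definition jacobian (g : R * R -> R * R) x : R :=
  d1 (fun y => (g y).1) x * d2 (fun y => (g y).2) x -
  d2 (fun y => (g y).1) x * d1 (fun y => (g y).2) x.

(* The loop gamma : [0, 1] -> R^2 \ {c} has winding number w around c:
   theta and r are continuous polar coordinates of gamma centered at c
   (continuity of r follows from that of gamma). *)
Definition winding (gamma : R -> R * R) c (w : int) :=
  exists theta r : R -> R,
    [/\ {within `[0, 1], continuous theta},
        forall t, t \in `[0, 1] -> 0 < r t /\
          gamma t = (c.1 + r t * cos (theta t), c.2 + r t * sin (theta t))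
      & theta 1 - theta 0 = 2 * pi * w%:~R].

(* A local homeomorphism g preserves the orientation at x: its local degree at
   x is 1, that is, g preserves the winding number of small loops around x.
   This makes sense for maps that are only continuous. *)
Definition orientation_preserving_at (g : R * R -> R * R) x :=
  exists2 U, nbhs x U & forall gamma : R -> R * R,
    {within `[0, 1], continuous gamma} -> gamma 0 = gamma 1 ->
    (forall t, t \in `[0, 1] -> U (gamma t) /\ gamma t != x) ->
    forall w, winding gamma x w <-> winding (g \o gamma) (g x) w.

Definition disc (r : R) : set (R * R) := [set x | x.1 ^+ 2 + x.2 ^+ 2 < r ^+ 2].

End Plane.

Section Surfaces.
Variables (R : realType) (S : topologicalType).

Record chart := Chart {
  dom : set S;
  coord : S -> R * R;
  icoord : R * R -> S }.

Definition is_chart (c : chart) :=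
  [/\ open (dom c) /\ open (coord c @` dom c),
      forall x, dom c x -> icoord c (coord c x) = x,
      {within dom c, continuous (coord c)}
    & {within coord c @` dom c, continuous (icoord c)}].

Definition closed_oriented_surface (A : set chart) :=
  [/\ compact [set: S] /\ hausdorff_space S,
      forall c, A c -> is_chart c,
      forall x, exists2 c, A c & dom c x
    & forall c d, A c -> A d ->
        let V := coord c @` (dom c `&` dom d) in
        let tau := coord d \o icoord c in
        smooth_map V tau /\ forall y, V y -> 0 < jacobian tau y].

Record homeomorphism := Homeomorphism {
  hfun :> S -> S;
  hinv : S -> S;
  hfunK : cancel hfun hinv;
  hinvK : cancel hinv hfun;
  hfun_continuous : continuous hfun;
  hinv_continuous : continuous hinv }.

Definition hpow (f : homeomorphism) (m : int) : S -> S :=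
  match m with
  | Posz n => iter n f
  | Negz n => iter n.+1 (hinv f)
  end.

Definition orientation_preserving (A : set chart) (f : S -> S) :=
  forall x c d, A c -> A d -> dom c x -> dom d (f x) ->
    orientation_preserving_at (coord d \o f \o icoord c) (coord c x).

(* A parametrized arc; only the values on [0, 1] matter.  In a Hausdorff space
   it is a homeomorphism from [0, 1] onto its image. *)
Definition is_arc (gamma : R -> S) :=
  {within `[0, 1], continuous gamma} /\
  {in `[0, 1] &, injective gamma}.

Definition image_arc (gamma : R -> S) : set S := gamma @` `[0, 1].
Definition interior_arc (gamma : R -> S) : set S := gamma @` `]0, 1[.

Definition closed_interval (I : set S) :=
  exists2 gamma : R -> S, is_arc gamma & I = image_arc gamma.

(* The reverse of an arc being an arc, these are both endpoints. *)
Definition endpoint (I : set S) (x : S) :=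
  exists gamma : R -> S, [/\ is_arc gamma, I = image_arc gamma & x = gamma 0].

Definition path_component (B : set S) (x : S) : set S :=
  [set y | exists gamma : R -> S,
    [/\ {within `[0, 1], continuous gamma}, gamma 0 = x, gamma 1 = y
      & image_arc gamma `<=` B]].

Definition components (B : set S) : set (set S) :=
  [set C | exists2 x, B x & C = connected_component B x].

End Surfaces.

Variant direction := Stable | Unstable.
Definition opp d := if d is Stable then Unstable else Stable.

(* A pair of transverse measured singular foliations: [prong p] is the number
   of prongs at p, [leaf d p] the leaf through p, and [mu d] the measure
   transverse to the foliation of direction d, defined on arcs. *)
Record foliations (R : realType) (S : Type) := Foliations {
  prong : S -> nat;
  leaf : direction -> S -> set S;
  mu : direction -> set S -> R }.

Section Foliations.
Variables (R : realType) (S : topologicalType).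
Implicit Types (F : foliations R S) (d : direction) (c : chart R S).

(* On the model k-prong z^(k-2) dz^2, the coordinate transverse to direction d
   is |Im z^(k/2)| for the stable and |Re z^(k/2)| for the unstable foliation;
   the absolute values make these well defined for odd k, by
   (Im z^(k/2))^2 = (|z|^k - Re z^k) / 2 and
   (Re z^(k/2))^2 = (|z|^k + Re z^k) / 2. *)
Definition height (k : nat) d (z : R * R) : R :=
  let re := complex.Re (Complex z.1 z.2 ^+ k) in
  let no := Num.sqrt (z.1 ^+ 2 + z.2 ^+ 2) ^+ k in
  if d is Stable then Num.sqrt ((no - re) / 2) else Num.sqrt ((no + re) / 2).

(* The component containing x of the intersection of its leaf with B, for the
   intrinsic topology of the leaf.  For that topology path components must be
   used: a path of S contained in a leaf is continuous for the topology of the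
   leaf (it has countably many heights in each chart), whereas distinct
   components may be connected to each other by the topology induced by S. *)
Definition leaf_component F d (B : set S) (x : S) : set S :=
  path_component R (leaf F d x `&` B) x.

(* The chart c, centered at p, sends both foliations and both measures to
   those of the model prong. *)
Definition natural_chart F (p : S) c :=
  [/\ is_chart c, dom c p, coord c p = (0, 0),
      exists2 r : R, 0 < r & coord c @` dom c = disc r
    & forall d, let h x := height (prong F p) d (coord c x) in
      (forall x, dom c x ->
         leaf_component F d (dom c) x =
         path_component R [set y | dom c y /\ h y = h x] x) /\
      (forall gamma : R -> S, is_arc gamma -> image_arc gamma `<=` dom c ->
         {in `[0, 1] &, {homo h \o gamma : s t / s < t}} ->
         mu F d (image_arc gamma) = h (gamma 1) - h (gamma 0))].

(* Arcs that are finite concatenations of pieces transverse to direction d;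
   a transverse arc crossing a prong in a chart is cut there. *)
Definition transverse_arc F d (gamma : R -> S) :=
  is_arc gamma /\
  exists (n : nat) (t : nat -> R),
    [/\ t 0%N = 0, t n = 1
      & forall i, (i < n)%N -> t i < t i.+1 /\
        exists p c, [/\ natural_chart F p c,
          gamma @` `[t i, t i.+1] `<=` dom c
        & let h s := height (prong F p) d (coord c (gamma s)) in
          {in `[t i, t i.+1] &, {homo h : s s' / s < s'}} \/
          {in `[t i, t i.+1] &, {homo h : s s' / s < s' >-> s' < s}}]].

Definition transverse_measured_foliations F :=
  [/\ forall p, (0 < prong F p)%N /\ exists c, natural_chart F p c,
      forall d x, leaf F d x x,
      forall d x y, leaf F d x y -> leaf F d y = leaf F d x,
      forall d x y, leaf F d x y -> path_component R (leaf F d x) x y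
    & forall d (gamma : R -> S) (t : R), transverse_arc F d gamma -> 0 < t < 1 ->
        mu F d (image_arc gamma) =
        mu F d (gamma @` `[0, t]) + mu F d (gamma @` `[t, 1])].

Definition generalized_pseudo_anosov (A : set (chart R S)) F
    (f : homeomorphism S) :=
  [/\ orientation_preserving A f, transverse_measured_foliations F,
      (forall x, prong F (f x) = prong F x) /\
      (forall d x, f @` leaf F d x = leaf F d (f x))
    & exists2 lambda : R, 1 < lambda & forall d (gamma : R -> S),
        transverse_arc F d gamma ->
        mu F d (f @` image_arc gamma) =
        (if d is Stable then lambda else lambda^-1) * mu F d (image_arc gamma)].

Definition singularities F : set S := [set p | prong F p <> 2].

(* Sing(f); without singularities it is a choice of periodic points. *)
Definition is_Sing F (f : homeomorphism S) (Sing : set S) :=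
  (singularities F !=set0 -> Sing = singularities F) /\
  (singularities F = set0 ->
    [/\ Sing !=set0, finite_set Sing, f @` Sing = Sing
      & forall p, Sing p -> exists2 n, (0 < n)%N & iter n f p = p]).

Definition separatrix F d (p : S) (X : set S) :=
  exists2 y, (leaf F d p `\ p) y & X = path_component R (leaf F d p `\ p) y.

Definition leaf_arc F d (gamma : R -> S) :=
  is_arc gamma /\ image_arc gamma `<=` leaf F d (gamma 0).

Definition leaf_arc_between F d (p x : S) (I : set S) :=
  exists gamma : R -> S, [/\ leaf_arc F d gamma, gamma 0 = p, gamma 1 = x
                  & I = image_arc gamma].

Definition first_intersection F (Sing : set S) (x : S) :=
  ~ Sing x /\
  exists p q, exists X Y I J : set S,
    [/\ Sing p /\ Sing q,
        separatrix F Stable p X /\ separatrix F Unstable q Y,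
        X x /\ Y x,
        leaf_arc_between F Stable p x I /\ leaf_arc_between F Unstable q x J
      & (I `\ p) `&` (J `\ q) = [set x]].

(* A rectangle is represented by its interior r, a trivially bi-foliated set;
   the rectangle itself is closure r.  (The closure does not determine r, for
   instance when it is the whole surface.) *)
Definition trivially_bifoliated F (r : set S) :=
  [/\ open r, connected r, r !=set0
    & forall x y, r x -> r y ->
        let I := closure (leaf_component F Stable r x) in
        let J := closure (leaf_component F Unstable r y) in
        [/\ closed_interval R I, closed_interval R J
          & exists2 w, r w & I `&` J = [set w]]].

Definition square : set (R * R) := [set z | 0 <= z.1 <= 1 /\ 0 <= z.2 <= 1].
Definition open_square : set (R * R) := [set z | 0 < z.1 < 1 /\ 0 < z.2 < 1].

(* The horizontal segment at height a (Stable), or the vertical one at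
   abscissa a (Unstable). *)
Definition segment (rho : R * R -> S) d (a : R) : R -> S :=
  fun t => if d is Stable then rho (t, a) else rho (a, t).

Definition parametrization (A : set (chart R S)) F (r : set S)
    (rho : R * R -> S) :=
  [/\ {within square, continuous rho} /\ rho @` square = closure r,
      rho @` open_square = r /\
      (exists rho' : S -> R * R,
         (forall z, open_square z -> rho' (rho z) = z) /\
         {within r, continuous rho'}),
      forall z c, open_square z -> A c -> dom c (rho z) ->
        orientation_preserving_at (coord c \o rho) z
    & forall d a, a \in `[0, 1] -> leaf_arc F d (segment rho d a)].

(* With d = Stable, C is the interior of a horizontal subrectangle of the
   rectangle with interior r; with d = Unstable, of a vertical one. *)
Definition subrectangle F d (C r : set S) :=
  [/\ trivially_bifoliated F C, closure C `<=` closure r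
    & forall x, C x -> leaf_component F d C x = leaf_component F d r x].

(* The vertical direction of a geometric rectangle is the strict order along
   the interiors of its vertical leaves. *)
Record geom_rectangle := GeomRectangle {
  rint : set S;
  vert : S -> S -> Prop }.

(* The order induced through rho by the orientation xi of the lines of
   direction xi. *)
Definition induced_order (rho : R * R -> S) (xi : R * R) (x y : S) :=
  exists z z', [/\ open_square z, open_square z', rho z = x, rho z' = y
    & exists2 s : R, 0 < s & z' = (z.1 + s * xi.1, z.2 + s * xi.2)].

Definition vertical_unit (xi : R * R) := xi = (0, 1) \/ xi = (0, -1).
Definition horizontal_unit (xi : R * R) := xi = (1, 0) \/ xi = (-1, 0).
Definition det2 (v w : R * R) : R := v.1 * w.2 - v.2 * w.1.

Definition is_geom_rectangle A F (G : geom_rectangle) :=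
  trivially_bifoliated F (rint G) /\
  exists rho xi, [/\ parametrization A F (rint G) rho, vertical_unit xi
    & forall x y, vert G x y <-> induced_order rho xi x y].

(* The horizontal direction is the one for which (vertical, horizontal), in
   this order, is a direct frame: if "up" is (0, 1), then "right" is (-1, 0). *)
Definition horiz A F (G : geom_rectangle) (x y : S) :=
  exists rho xiv xih,
    [/\ parametrization A F (rint G) rho,
        [/\ vertical_unit xiv, horizontal_unit xih & 0 < det2 xiv xih],
        forall x' y', vert G x' y' <-> induced_order rho xiv x' y'
      & induced_order rho xih x y].

Definition geom_markov_partition A F (f : homeomorphism S) N
    (G : 'I_N -> geom_rectangle) :=
  [/\ forall i, is_geom_rectangle A F (G i),
      \bigcup_(i : 'I_N) closure (rint (G i)) = [set: S],
      forall i j, i <> j -> rint (G i) `&` rint (G j) = set0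
    & forall i j,
      (forall C, components (rint (G i) `&` f @^-1` rint (G j)) C ->
         subrectangle F Stable C (rint (G i))) /\
      (forall C, components (f @` rint (G i) `&` rint (G j)) C ->
         subrectangle F Unstable C (rint (G j)))].

Definition induced_rectangle (h : S -> S) (G : geom_rectangle) :=
  GeomRectangle (h @` rint G)
    (fun x y => exists x' y', [/\ h x' = x, h y' = y & vert G x' y']).

End Foliations.

Record geom_type := GeomType {
  gN : nat;
  gh : 'I_gN -> nat;
  gv : 'I_gN -> nat;
  grho : {i : 'I_gN & 'I_(gh i)} -> {k : 'I_gN & 'I_(gv k)};
  geps : {i : 'I_gN & 'I_(gh i)} -> int }.

Definition empty_geom_type : geom_type :=
  @GeomType 0 (fun=> 0%N) (fun=> 0%N) id (fun=> 1).

Section GeometricTypes.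
Variables (R : realType) (S : topologicalType) (A : set (chart R S)).
Variables (F : foliations R S) (f : homeomorphism S).

(* E lists the sets in X without repetition, increasingly for the order lt
   between points. *)
Definition increasing_enumeration (lt : S -> S -> Prop) (X : set (set S)) n
    (E : 'I_n -> set S) :=
  [/\ injective E, range E = X
    & forall i j : 'I_n, (i < j)%N -> exists x y, [/\ E i x, E j y & lt x y]].

Definition horizontal_components N (G : 'I_N -> geom_rectangle S) i :=
  components (rint (G i) `&` \bigcup_(j : 'I_N) (f @^-1` rint (G j))).

Definition vertical_components N (G : 'I_N -> geom_rectangle S) k :=
  components (rint (G k) `&` \bigcup_(i : 'I_N) (f @` rint (G i))).

(* H i j and V k l are the interiors of the subrectangles H^i_j and V^k_l. *)
Definition is_geometric_type N (G : 'I_N -> geom_rectangle S) (T : geom_type) :=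
  exists (h v : 'I_N -> nat)
    (rho : {i : 'I_N & 'I_(h i)} -> {k : 'I_N & 'I_(v k)})
    (eps : {i : 'I_N & 'I_(h i)} -> int)
    (H : forall i, 'I_(h i) -> set S) (V : forall k, 'I_(v k) -> set S),
  [/\ T = GeomType rho eps,
      forall i, increasing_enumeration (vert (G i))
                  (horizontal_components G i) (H i),
      forall k, increasing_enumeration (horiz A F (G k))
                  (vertical_components G k) (V k),
      forall a b, rho a = b <->
        f @` closure (H (tag a) (tagged a)) = closure (V (tag b) (tagged b))
    & forall a,
        let preserves_vertical := forall x y,
          H (tag a) (tagged a) x -> H (tag a) (tagged a) y ->
          vert (G (tag a)) x y -> vert (G (tag (rho a))) (f x) (f y) in
        (preserves_vertical -> eps a = 1) /\
        (~ preserves_vertical -> eps a = -1)].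

(* The default value is never taken when G is a geometric Markov partition: its
   geometric type then exists and is unique. *)
Definition geometric_type N (G : 'I_N -> geom_rectangle S) : geom_type :=
  xget (empty_geom_type : {classic geom_type})
    [set T | is_geometric_type G T].

End GeometricTypes.

Section PrimitivePartitions.
Variables (R : realType) (S : topologicalType) (F : foliations R S).
Implicit Types (delta : set (set S)) (d : direction).

Definition support delta : set S := \bigcup_(I in delta) I.

Definition regular_part delta : set S :=
  support delta `\` [set x | exists2 I, delta I & endpoint R I x].

(* Rails of direction d, for a family delta of arcs of direction opp d. *)
Definition regular_rail d delta (J : set S) :=
  exists gamma : R -> S,
    [/\ leaf_arc F d gamma, J = image_arc gamma,
        interior_arc gamma `&` support delta = set0
      & regular_part delta (gamma 0) /\ regular_part delta (gamma 1)].

Definition extreme_rail (A : set (chart R S)) d delta (J : set S) :=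
  (exists gamma : R -> S, [/\ leaf_arc F d gamma, J = image_arc gamma
     & ~ (regular_part delta (gamma 0) /\ regular_part delta (gamma 1))]) /\
  exists (r : set S) (rho : R * R -> S) (a : R),
    [/\ trivially_bifoliated F r /\ parametrization A F r rho,
        {in @square R &, injective rho},
        image_arc (segment rho (opp d) 0) `|` image_arc (segment rho (opp d) 1)
          `<=` support delta,
        (a = 0 \/ a = 1) /\ J = image_arc (segment rho d a)
      & forall b, b \in `[0, 1] -> b <> a ->
          regular_rail d delta (image_arc (segment rho d b))].

Definition compatible (A : set (chart R S)) (deltas deltau : set (set S)) :=
  [/\ forall I x, deltas I -> endpoint R I x -> support deltau x,
      forall I x, deltau I -> endpoint R I x -> support deltas x,
      forall J, extreme_rail A Unstable deltas J -> J `<=` support deltau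
    & forall J, extreme_rail A Stable deltau J -> J `<=` support deltas].

Variables (f : homeomorphism S) (Sing : set S).

(* The segments of direction d from Sing to P with interior disjoint from P. *)
Definition segments_to d (P : set S) : set (set S) :=
  [set I | exists gamma : R -> S,
    [/\ leaf_arc F d gamma, Sing (gamma 0), P (gamma 1),
        interior_arc gamma `&` P = set0 & I = image_arc gamma]].

(* [q, z]^u, where q is the point of Sing on the unstable leaf of z; such a
   point is unique because a leaf contains at most one periodic point. *)
Definition Ju (z : S) : set S :=
  [set x | exists q I, [/\ Sing q, leaf_arc_between F Unstable q z I & I x]].

Definition Jcalu (z : S) : set S :=
  \bigcup_(i : nat) (iter i f @^-1` Ju z).

Definition deltas (z : S) := segments_to Stable (Jcalu z).
Definition deltau (z : S) := segments_to Unstable (support (deltas z)).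

Definition iter_graph (n : nat) delta : set (set S) :=
  [set iter n f @` I | I in delta].

Definition is_compatibility_coefficient A (z : S) (k : nat) :=
  let good k := forall n, (k <= n)%N ->
    compatible A (deltas z) (iter_graph n (deltau z)) in
  good k /\ forall k', good k' -> (k <= k')%N.

(* The coefficient and the maximum below exist for a pseudo-Anosov map; the
   default value 0 is irrelevant. *)
Definition compatibility_coefficient A (z : S) : nat :=
  xget 0%N [set k | is_compatibility_coefficient A z k].

Definition is_compatibility_order A (k : nat) :=
  (exists2 z, first_intersection F Sing z &
     k = compatibility_coefficient A z) /\
  forall z, first_intersection F Sing z ->
    (compatibility_coefficient A z <= k)%N.

Definition compatibility_order A : nat :=
  xget 0%N [set k | is_compatibility_order A k].

(* The interiors of the rectangles of R(z, n). *)
Definition primitive_partition (z : S) (n : nat) : set (set S) :=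
  components
    (~` (support (deltas z) `|` support (iter_graph n (deltau z)))).

(* G is R(z, n) with a labeling and vertical directions. *)
Definition geom_primitive_partition A (z : S) (n : nat) N
    (G : 'I_N -> geom_rectangle S) :=
  [/\ geom_markov_partition A F f G, injective (fun i => rint (G i))
    & range (fun i => rint (G i)) = primitive_partition z n].

End PrimitivePartitions.

(* Main.v *)
(* All the objects involved are defined from f, its two foliations, Sing(f) and
   the orientation of S.  A homeomorphism commuting with f and preserving the
   rest therefore carries the construction at z to the construction at its image
   and does not change the geometric type; f^m is such a homeomorphism.
   Each equivariance statement only needs an inclusion, the converse being the
   same inclusion for the inverse homeomorphism. *)
Require Import Defs.
From mathcomp Require Import all_boot all_order all_algebra.
From mathcomp Require Import all_classical all_reals all_analysis.
Set Implicit Arguments. Unset Strict Implicit. Unset Printing Implicit Defensive.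
Import Order.TTheory GRing.Theory Num.Theory numFieldNormedType.Exports.
Local Open Scope classical_set_scope.
Local Open Scope ring_scope.

(** * Continuity on subsets *)

Lemma within_continuous_comp (T U V : topologicalType) (B : set T) (g : T -> U)
    (k : U -> V) :
  {within B, continuous g} -> (forall x, B x -> {for g x, continuous k}) ->
  {within B, continuous (k \o g)}.
Proof.
move=> /subspace_continuousP gB kB; apply/subspace_continuousP => x Bx.
exact: cvg_comp (gB x Bx) (kB x Bx).
Qed.

Lemma within_continuous_at (T U : topologicalType) (B : set T) (g : T -> U) x :
  nbhs x B -> {within B, continuous g} -> {for x, continuous g}.
Proof.
move=> xB /(_ x); rewrite /continuous_at -nbhs_subspace_interior //.
Qed.

(** * Local degree of planar maps under composition *)

Section Orientation.
Variable R : realType.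
Implicit Types (g k : R * R -> R * R) (x : R * R).

Lemma eq_winding (gamma gamma' : R -> R * R) x w :
  {in `[0, 1], gamma =1 gamma'} -> winding gamma x w <-> winding gamma' x w.
Proof.
move=> e; split=> -[theta [r [ct polar turn]]]; exists theta, r; split=> // t t01;
  have [r0 <-] := polar t t01; by rewrite e.
Qed.

(** Small loops around [x] are sent by [k] to loops around [k x], on which [g] keeps the winding
    number. So [k] and [g \o k] change the winding number of a loop in the same way. The equivalence
    lets [g] be added as well as cancelled. *)
Lemma orientation_preserving_at_comp g k x :
  (\forall y \near x, {for y, continuous k}) ->
  (\forall y \near x, k y = k x -> y = x) ->
  orientation_preserving_at g (k x) ->
  orientation_preserving_at (g \o k) x <-> orientation_preserving_at k x.
Proof.
move=> ck ik [U kU gU].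
have xW : nbhs x ([set y | {for y, continuous k}] `&`
    [set y | k y = k x -> y = x] `&` (k @^-1` U)).
  by apply: filterI; [exact: filterI|exact: (nbhs_singleton ck)].
(* On this neighbourhood [k] takes the value [k x] only at [x], so [k \o gamma] avoids [k x]; it
   also stays in [U], where the local degree of [g] is known. *)
have transfer (gamma : R -> R * R) :
    {within `[0, 1], continuous gamma} -> gamma 0 = gamma 1 ->
    (forall t, t \in `[0, 1] -> ([set y | {for y, continuous k}] `&`
       [set y | k y = k x -> y = x] `&` (k @^-1` U)) (gamma t) /\ gamma t != x) ->
    forall w, winding (k \o gamma) (k x) w <->
              winding (g \o (k \o gamma)) (g (k x)) w.
  move=> cgamma loop gammaW; apply: gU.
  - by apply: within_continuous_comp cgamma _ => t /gammaW [[[]]].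
  - by rewrite /= loop.
  - move=> t /gammaW [[[_ ikt] Ukt] /eqP tx]; split=> //=.
    by apply/eqP => /ikt.
split=> -[V xV gV]; exists (V `&` ([set y | {for y, continuous k}] `&`
    [set y | k y = k x -> y = x] `&` (k @^-1` U))); try exact: filterI;
  move=> gamma cgamma loop gammaW w;
  have kw := transfer gamma cgamma loop
    (fun t t01 => conj (gammaW t t01).1.2 (gammaW t t01).2) w;
  have vw := gV gamma cgamma loop
    (fun t t01 => conj (gammaW t t01).1.1 (gammaW t t01).2) w.
- by apply: (iff_trans vw); apply: iff_sym.
- by apply: (iff_trans vw).
Qed.

Lemma near_eq_orientation_preserving_at g k x :
  (\forall y \near x, g y = k y) ->
  orientation_preserving_at g x -> orientation_preserving_at k x.
Proof.
move=> gk [U xU gU]; exists (U `&` [set y | g y = k y]); first exact: filterI.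
move=> gamma cgamma loop gammaU w.
have [|gw wg] := gU gamma cgamma loop _ w.
  by move=> t /gammaU [[]].
have gkgamma : {in `[0, 1], g \o gamma =1 k \o gamma}.
  by move=> t /gammaU [[]].
have [e1 e2] := eq_winding (k x) w gkgamma.
(* The centres of the two windings agree too, since [g] and [k] coincide at [x] itself. *)
rewrite -(nbhs_singleton gk) in e1 e2 *.
by split=> [/gw/e1|/e2/wg].
Qed.

End Orientation.

(** * Topological constructions under a homeomorphism *)

Section Homeomorphisms.
Variables (R : realType) (S : topologicalType).
Implicit Types (h : homeomorphism S) (B C : set S) (x y : S).

Definition hinverse h : homeomorphism S :=
  Homeomorphism (@hinvK S h) (@hfunK S h)
    (@hinv_continuous S h) (@hfun_continuous S h).

Definition hcomp h k : homeomorphism S :=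
  Homeomorphism (can_comp (@hfunK S h) (@hfunK S k))
    (can_comp (@hinvK S k) (@hinvK S h))
    (fun x => continuous_comp (@hfun_continuous S k x)
       (@hfun_continuous S h (k x)))
    (fun x => continuous_comp (@hinv_continuous S h x)
       (@hinv_continuous S k (hinv h x))).

Definition hid : homeomorphism S :=
  Homeomorphism (fun x : S => erefl x) (fun x => erefl x)
    (fun x => @cvg_id S (nbhs x)) (fun x => @cvg_id S (nbhs x)).

(** Preimages commute with intersections and complements by mere computation; images under a
    homeomorphism inherit this. *)
Lemma image_hinv h B : h @` B = hinv h @^-1` B.
Proof.
apply/seteqP; split=> [_ [x Bx <-]|x Bx]; first by rewrite /preimage /= hfunK.
by exists (hinv h x) => //; rewrite hinvK.
Qed.

Lemma hinv_imageK h B : hinv h @` (h @` B) = B.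
Proof.
rewrite (image_hinv (hinverse h)) image_hinv /=.
by apply/seteqP; split=> x; rewrite /preimage /= hfunK.
Qed.

Lemma image_hinvK h B : h @` (hinv h @` B) = B.
Proof. exact: (hinv_imageK (hinverse h)). Qed.

Lemma mem_himage h B x : (h @` B) (h x) = B x.
Proof. by rewrite image_hinv /preimage /= hfunK. Qed.

Lemma himage_inj h : injective (fun B => h @` B).
Proof. exact: (can_inj (g := fun B => hinv h @` B)) (hinv_imageK h). Qed.

Lemma himage_eq h B C : h @` B `<=` C -> hinv h @` C `<=` B -> h @` B = C.
Proof.
move=> BC CB; apply/seteqP; split=> //.
by rewrite -{1}(image_hinvK h C); exact: image_subset.
Qed.

Lemma himageI h B C : h @` (B `&` C) = h @` B `&` h @` C.
Proof. by rewrite !image_hinv. Qed.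

Lemma himageC h B : h @` (~` B) = ~` (h @` B).
Proof. by rewrite !image_hinv. Qed.

Lemma himageD1 h B x : h @` (B `\ x) = (h @` B) `\ h x.
Proof.
rewrite !image_hinv; apply/seteqP; split=> y [By yx]; split=> //= e; apply: yx => /=.
  by rewrite e hfunK.
by rewrite -e hinvK.
Qed.

Lemma hfun_inj h : injective h. Proof. exact: can_inj (@hfunK S h). Qed.

Lemma open_himage h B : open B -> open (h @` B).
Proof.
by rewrite image_hinv => oB; apply: open_comp => // y _; exact: hinv_continuous.
Qed.

Lemma closure_himage h B : closure (h @` B) = h @` closure B.
Proof.
have sub (k : homeomorphism S) C : k @` closure C `<=` closure (k @` C).
  move=> _ [x Cx <-] V /(@hfun_continuous S k x)/Cx [y [Cy Vy]].
  by exists (k y); split=> //; exists y.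
apply/esym/himage_eq; first exact: sub.
by rewrite -{2}(hinv_imageK h B); exact: (sub (hinverse h)).
Qed.

Lemma connected_himage h B : connected B -> connected (h @` B).
Proof.
move=> cB; apply: connected_continuous_connected => //.
by apply: continuous_subspaceT => x; exact: hfun_continuous.
Qed.

Lemma connected_component_himage h B x :
  connected_component (h @` B) (h x) = h @` connected_component B x.
Proof.
have sub (k : homeomorphism S) C y :
    k @` connected_component C y `<=` connected_component (k @` C) (k y).
  move=> _ [w [D [Dy DC cD] Dw] <-]; exists (k @` D); last by exists w.
  by split; [exists y|exact: image_subset|exact: connected_himage].
apply/esym/himage_eq; first exact: sub.
rewrite -{2}(hinv_imageK h B) -{2}(hfunK h x).
exact: (sub (hinverse h)).
Qed.

Lemma components_himage h B :
  components (h @` B) = [set h @` C | C in components B].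
Proof.
apply/seteqP; split=> [_ [_ [x Bx <-] ->]|_ [_ [x Bx ->] <-]].
  by exists (connected_component B x); [exists x|rewrite connected_component_himage].
by exists (h x); [exists x|rewrite connected_component_himage].
Qed.

Lemma image_arc_comp h (gamma : R -> S) :
  image_arc (h \o gamma) = h @` image_arc gamma.
Proof. by rewrite /image_arc image_comp. Qed.

Lemma within_continuous_hcomp h (T : topologicalType) (B : set T) (g : T -> S) :
  {within B, continuous g} -> {within B, continuous (h \o g)}.
Proof.
by move=> cg; apply: within_continuous_comp cg _ => x _; exact: hfun_continuous.
Qed.

Lemma path_component_himage h B x :
  path_component R (h @` B) (h x) = h @` path_component R B x.
Proof.
have sub (k : homeomorphism S) C y :
    k @` path_component R C y `<=` path_component R (k @` C) (k y).
  move=> _ [_ [gamma [cg <- <- gC]] <-]; exists (k \o gamma); split=> //.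
    exact: within_continuous_hcomp.
  by rewrite image_arc_comp; exact: image_subset.
apply/esym/himage_eq; first exact: sub.
rewrite -{2}(hinv_imageK h B) -{2}(hfunK h x).
exact: (sub (hinverse h)).
Qed.

Lemma is_arc_himage h (gamma : R -> S) : is_arc gamma -> is_arc (h \o gamma).
Proof.
move=> [cg ig]; split; first exact: within_continuous_hcomp.
by move=> s t s01 t01 /= /hfun_inj; exact: ig.
Qed.

Lemma closed_interval_himage h B :
  closed_interval R B -> closed_interval R (h @` B).
Proof.
move=> [gamma arc ->]; exists (h \o gamma); first exact: is_arc_himage.
by rewrite image_arc_comp.
Qed.

(** [hpow h m] is a bare function; this provides a homeomorphism with that underlying map, inside
    any class closed under the group operations. The class used is that of symmetries. *)
Lemma hpow_closed (P : homeomorphism S -> Prop) h m :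
  P hid -> P h -> P (hinverse h) -> (forall k l, P k -> P l -> P (hcomp k l)) ->
  exists2 k, P k & hpow h m = k.
Proof.
move=> P1 Ph Pi Pc.
have Piter k n : P k -> exists2 l, P l & iter n k = l.
  move=> Pk; elim: n => [|n [l Pl e]]; first by exists hid.
  exists (hcomp k l); first exact: Pc.
  by apply/funext => x; rewrite iterS e.
by case: m => n; [exact: Piter|exact: (Piter (hinverse h))].
Qed.

End Homeomorphisms.

(** * Symmetries of the foliations, of f and of Sing(f) *)

Section Symmetries.
Variables (R : realType) (S : topologicalType) (A : set (chart R S)).
Variables (F : foliations R S) (f : homeomorphism S) (Sing : set S).
Implicit Types (h : homeomorphism S) (B C r : set S) (x y z p : S).
Implicit Types (d : direction) (G : geom_rectangle S).

(** An equivalence on pairs of points, rather than an equality of image leaves, makes stability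
    under inverse and composition a matter of rewriting. *)
Definition preserves_leaves h :=
  forall d x y, leaf F d (h x) (h y) <-> leaf F d x y.

(* The orientation of S only matters through the parametrizations of the
   rectangles; keeping just that makes composition immediate. *)
Definition symmetry h :=
  [/\ preserves_leaves h, forall x, Sing (h x) <-> Sing x,
      forall x, h (f x) = f (h x)
    & forall r rho, parametrization A F (h @` r) (h \o rho) <->
                    parametrization A F r rho].

Lemma preserves_leaves_hinverse h :
  preserves_leaves h -> preserves_leaves (hinverse h).
Proof. by move=> hl d x y; rewrite -hl /= !hinvK. Qed.

Lemma symmetry_hinverse h : symmetry h -> symmetry (hinverse h).
Proof.
move=> [hl hS hf hp]; split.
- exact: preserves_leaves_hinverse.
- by move=> x; rewrite -hS /= hinvK.
- by move=> x /=; apply: (@hfun_inj _ h); rewrite hf !hinvK.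
- move=> r rho; rewrite -hp image_hinvK.
  by have -> : h \o (hinverse h \o rho) = rho by apply/funext => z /=; rewrite hinvK.
Qed.

Lemma symmetry_hcomp h k : symmetry h -> symmetry k -> symmetry (hcomp h k).
Proof.
move=> [hl hS hf hp] [kl kS kf kp]; split.
- by move=> d x y; rewrite /= hl.
- by move=> x; rewrite /= hS.
- by move=> x; rewrite /= kf hf.
- move=> r rho; rewrite -(kp r) -(hp (k @` r)).
  by rewrite (_ : hcomp h k @` r = h @` (k @` r)) // image_comp.
Qed.

Lemma symmetry_hid : symmetry (hid S).
Proof. by split=> // r rho; rewrite image_id. Qed.

(** * Constructions that depend on the leaves only *)

Section LeafPreserving.
Variable h : homeomorphism S.
Hypothesis hl : preserves_leaves h.

Lemma leaf_himage d x : leaf F d (h x) = h @` leaf F d x.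
Proof.
apply/seteqP; split=> [y|_ [y xy <-]]; last exact/hl.
by rewrite -{1}(hinvK h y) => /hl xy; exists (hinv h y) => //; rewrite hinvK.
Qed.

Lemma leaf_component_himage d B x :
  leaf_component F d (h @` B) (h x) = h @` leaf_component F d B x.
Proof. by rewrite /leaf_component leaf_himage -himageI path_component_himage. Qed.

Lemma leaf_arc_himage d (gamma : R -> S) :
  leaf_arc F d gamma -> leaf_arc F d (h \o gamma).
Proof.
move=> [arc gl]; split; first exact: is_arc_himage.
by rewrite image_arc_comp leaf_himage; exact: image_subset.
Qed.

Lemma leaf_arc_between_himage d x y B :
  leaf_arc_between F d x y B -> leaf_arc_between F d (h x) (h y) (h @` B).
Proof.
move=> [gamma [arc <- <- ->]]; exists (h \o gamma); split=> //.
- exact: leaf_arc_himage.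
- by rewrite image_arc_comp.
Qed.

Lemma separatrix_himage d p B :
  separatrix F d p B -> separatrix F d (h p) (h @` B).
Proof.
move=> [y yp ->]; exists (h y); last first.
  by rewrite leaf_himage -himageD1 path_component_himage.
by rewrite leaf_himage -himageD1; exists y.
Qed.

Lemma trivially_bifoliated_himage r :
  trivially_bifoliated F r -> trivially_bifoliated F (h @` r).
Proof.
move=> [ro rc [x rx] rIJ]; split.
- exact: open_himage.
- exact: connected_himage.
- by exists (h x), x.
- move=> _ _ [a ra <-] [b rb <-] /=.
  have [Ia Jb [w rw Iw]] := rIJ a b ra rb.
  rewrite !leaf_component_himage !closure_himage; split.
  + exact: closed_interval_himage.
  + exact: closed_interval_himage.
  + by exists (h w); [exists w|rewrite -himageI Iw image_set1].
Qed.

Lemma subrectangle_himage d C r :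
  subrectangle F d C r -> subrectangle F d (h @` C) (h @` r).
Proof.
move=> [Ctb Cr Cl]; split.
- exact: trivially_bifoliated_himage.
- by rewrite !closure_himage; exact: image_subset.
- by move=> _ [x Cx <-]; rewrite !leaf_component_himage Cl.
Qed.

(** Every clause but orientation follows from [h] being a homeomorphism that preserves leaves.
    Orientation involves the charts and is left as a hypothesis, to be checked separately for f and
    for its inverse. *)
Lemma parametrization_himage r rho : parametrization A F r rho ->
  (forall (t : R * R) c, open_square t -> A c -> dom c (h (rho t)) ->
     orientation_preserving_at (Defs.coord c \o (h \o rho)) t) ->
  parametrization A F (h @` r) (h \o rho).
Proof.
move=> [[rc rsq] [rosq [rho' [rhoK crho']]] _ rleaf] ho; split=> //.
- split; first exact: within_continuous_hcomp.
  by rewrite closure_himage -rsq image_comp.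
- split; first by rewrite -rosq image_comp.
  exists (rho' \o hinv h); split; first by move=> t tsq; rewrite /= hfunK rhoK.
  apply/subspace_continuousP => _ [x rx <-] /=.
  rewrite [X in _ --> X]/from_subspace /= hfunK.
  apply: (@cvg_comp _ _ _ (hinv h) rho' _ (within r (nbhs x)) (nbhs (rho' x))).
    move=> B xB; have := @hinv_continuous S h (h x).
    rewrite /continuous_at hfunK => /(_ _ xB) hxB.
    apply: (@filterS _ (nbhs (h x)) _ _ _ _ hxB) => y /= yB [w rw wy].
    by apply: yB; rewrite -wy hfunK.
  by move/subspace_continuousP: crho' => crho'; exact: crho' rx.
- move=> d a a01; rewrite (_ : segment _ d a = h \o segment rho d a).
    exact: leaf_arc_himage (rleaf d a a01).
  by case: d.
Qed.

End LeafPreserving.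

(** * Transport of geometric Markov partitions by a symmetry *)

Section Transport.
Variable h : homeomorphism S.
Hypothesis hsym : symmetry h.

Let hl : preserves_leaves h. Proof. by case: hsym. Qed.
Let hS x : Sing (h x) <-> Sing x. Proof. by case: hsym. Qed.
Let hf x : h (f x) = f (h x). Proof. by case: hsym. Qed.
Let hp r rho : parametrization A F r rho ->
  parametrization A F (h @` r) (h \o rho).
Proof. by case: hsym => _ _ _ hp /hp. Qed.

Lemma symmetry_iter n x : h (iter n f x) = iter n f (h x).
Proof. by elim: n => //= n <-. Qed.

Lemma symmetry_image_iter n B : h @` (iter n f @` B) = iter n f @` (h @` B).
Proof.
rewrite !image_comp; congr (_ @` _).
by apply/funext => x; exact: symmetry_iter.
Qed.

Lemma first_intersection_himage z :
  first_intersection F Sing z -> first_intersection F Sing (h z).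
Proof.
move=> [zS [p [q [X [Y [I [J [[pS qS] [pX qY] [Xz Yz] [pI qJ] IJ]]]]]]]].
split; first by move/hS.
exists (h p), (h q), (h @` X), (h @` Y), (h @` I), (h @` J); split.
- by split; apply/hS.
- by split; exact: separatrix_himage.
- by rewrite !mem_himage.
- by split; exact: leaf_arc_between_himage.
- by rewrite -!himageD1 -himageI IJ image_set1.
Qed.

Lemma vert_induced G x y : vert (induced_rectangle h G) (h x) (h y) = vert G x y.
Proof.
apply/propext; split=> [[x' [y' [/hfun_inj -> /hfun_inj ->]]] //|xy].
by exists x, y.
Qed.

Lemma induced_order_himage (rho : R * R -> S) (xi : R * R) x y :
  induced_order (h \o rho) xi (h x) (h y) <-> induced_order rho xi x y.
Proof.
split=> -[a [b [oa ob ax bx ab]]]; exists a, b; split=> //.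
- exact: hfun_inj ax.
- exact: hfun_inj bx.
- by rewrite /= ax.
- by rewrite /= bx.
Qed.

Lemma vert_induced_order G rho (xi : R * R) :
  (forall x y, vert G x y <-> induced_order rho xi x y) ->
  forall x y, vert (induced_rectangle h G) x y <-> induced_order (h \o rho) xi x y.
Proof.
move=> Gv x y; rewrite -(hinvK h x) -(hinvK h y) vert_induced Gv.
by rewrite induced_order_himage.
Qed.

Lemma is_geom_rectangle_induced G :
  is_geom_rectangle A F G -> is_geom_rectangle A F (induced_rectangle h G).
Proof.
move=> [Gtb [rho [xi [param vxi Gv]]]]; split.
  exact: trivially_bifoliated_himage.
exists (h \o rho), xi; split=> //; first exact: hp.
exact: vert_induced_order.
Qed.

(** Composing the parametrization with [h] keeps both unit vectors, hence the direct frame; that the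
    composite is still a parametrization is where orientation enters. One implication suffices, as
    orders occur only positively in [increasing_enumeration]. *)
Lemma horiz_induced G x y :
  horiz A F G x y -> horiz A F (induced_rectangle h G) (h x) (h y).
Proof.
move=> [rho [xiv [xih [param xis Gv xy]]]].
exists (h \o rho), xiv, xih; split=> //; first exact: hp.
- exact: vert_induced_order.
- exact/induced_order_himage.
Qed.

(** All [n] occur in the union [Jcalu]; the case [n = 1], convertible to f, handles the Markov
    condition and the subrectangles. *)
Lemma symmetry_preimage_iter n B :
  h @` (iter n f @^-1` B) = iter n f @^-1` (h @` B).
Proof.
rewrite !image_hinv; apply/seteqP; split=> x; rewrite /preimage /=.
  by rewrite -{2}(hinvK h x) -symmetry_iter hfunK.
by rewrite -{1}(hinvK h x) -symmetry_iter hfunK.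
Qed.

Lemma geom_markov_partition_induced N (G : 'I_N -> geom_rectangle S) :
  geom_markov_partition A F f G ->
  geom_markov_partition A F f (fun i => induced_rectangle h (G i)).
Proof.
move=> [Gr Gcover Gdisj Gmarkov]; split.
- by move=> i; exact: is_geom_rectangle_induced.
- apply/seteqP; split=> // x _.
  have : [set: S] (hinv h x) by [].
  rewrite -Gcover => -[i _ ix]; exists i => //=.
  by rewrite closure_himage; exists (hinv h x) => //; rewrite hinvK.
- by move=> i j ij /=; rewrite -himageI Gdisj // image_set0.
- move=> i j; have [horizontal vertical] := Gmarkov i j; split=> D /=.
  + rewrite -(symmetry_preimage_iter 1) -himageI components_himage => -[C CC <-].
    exact/subrectangle_himage/horizontal.
  + rewrite -(symmetry_image_iter 1) -himageI components_himage => -[C CC <-].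
    exact/subrectangle_himage/vertical.
Qed.

(** * Equivariance of the adapted graphs and of the primitive partitions *)

Lemma Ju_himage z : Ju F Sing (h z) = h @` Ju F Sing z.
Proof.
have sub k y : symmetry k -> k @` Ju F Sing y `<=` Ju F Sing (k y).
  move=> [kl kS _ _] _ [x [q [I [qS qI Ix]]] <-].
  exists (k q), (k @` I); split; first exact/kS.
    exact: leaf_arc_between_himage.
  by exists x.
apply/esym/himage_eq; first exact: sub.
rewrite -{2}(hfunK h z).
by apply: (sub (hinverse h)); exact: symmetry_hinverse.
Qed.

Lemma Jcalu_himage z : Jcalu F f Sing (h z) = h @` Jcalu F f Sing z.
Proof.
rewrite /Jcalu Ju_himage image_bigcup; apply: eq_bigcup => // i _.
by rewrite symmetry_preimage_iter.
Qed.

(** Serves twice: for [deltas], with [B] the invariant arcs [Jcalu], then for [deltau], with [B] the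
    support of [deltas]. *)
Lemma segments_to_himage d B :
  segments_to F Sing d (h @` B) = [set h @` I | I in segments_to F Sing d B].
Proof.
have sub k C I : symmetry k -> segments_to F Sing d C I ->
    segments_to F Sing d (k @` C) (k @` I).
  move=> [kl kS _ _] [gamma [arc g0 g1 gC ->]]; exists (k \o gamma); split.
  - exact: leaf_arc_himage.
  - exact/kS.
  - by exists (gamma 1).
  - by rewrite /interior_arc -image_comp -himageI [X in k @` X]gC image_set0.
  - by rewrite image_arc_comp.
apply/seteqP; split=> [I BI|_ [I BI <-]]; last exact: sub.
exists (hinv h @` I); last exact: image_hinvK.
rewrite -(hinv_imageK h B); apply: (sub (hinverse h)) => //.
exact: symmetry_hinverse.
Qed.

Lemma support_himage (delta : set (set S)) :
  Defs.support [set h @` I | I in delta] = h @` Defs.support delta.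
Proof. by rewrite /Defs.support bigcup_image image_bigcup. Qed.

Lemma deltas_himage z :
  deltas F f Sing (h z) = [set h @` I | I in deltas F f Sing z].
Proof. by rewrite /deltas Jcalu_himage segments_to_himage. Qed.

Lemma deltau_himage z :
  deltau F f Sing (h z) = [set h @` I | I in deltau F f Sing z].
Proof. by rewrite /deltau deltas_himage support_himage segments_to_himage. Qed.

Lemma iter_graph_himage n (delta : set (set S)) :
  iter_graph f n [set h @` I | I in delta] =
  [set h @` I | I in iter_graph f n delta].
Proof.
rewrite /iter_graph !image_comp; apply: eq_imagel => I _ /=.
by rewrite symmetry_image_iter.
Qed.

Lemma primitive_partition_himage z n :
  primitive_partition F f Sing (h z) n =
  [set h @` C | C in primitive_partition F f Sing z n].
Proof.
rewrite /primitive_partition deltau_himage iter_graph_himage deltas_himage.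
by rewrite !support_himage -image_setU -himageC components_himage.
Qed.

Lemma geom_primitive_partition_induced z n N (G : 'I_N -> geom_rectangle S) :
  geom_primitive_partition F f Sing A z n G ->
  geom_primitive_partition F f Sing A (h z) n
    (fun i => induced_rectangle h (G i)).
Proof.
move=> [Gm Ginj Gz]; split; first exact: geom_markov_partition_induced.
- by move=> i j /= /himage_inj /Ginj.
- by rewrite primitive_partition_himage -Gz image_comp.
Qed.

(** * Invariance of the geometric type *)

Lemma increasing_enumeration_himage (lt lt' : S -> S -> Prop)
    (X : set (set S)) n (E : 'I_n -> set S) :
  (forall x y, lt x y -> lt' (h x) (h y)) -> increasing_enumeration lt X E ->
  increasing_enumeration lt' [set h @` C | C in X] (fun i => h @` E i).
Proof.
move=> ltlt' [Einj EX Elt]; split.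
- by move=> i j /himage_inj /Einj.
- by rewrite -EX image_comp.
- move=> i j /Elt [x [y [Eix Ejy xy]]]; exists (h x), (h y).
  by split; [exists x|exists y|exact: ltlt'].
Qed.

Lemma horizontal_components_induced N (G : 'I_N -> geom_rectangle S) i :
  horizontal_components f (fun i => induced_rectangle h (G i)) i =
  [set h @` C | C in horizontal_components f G i].
Proof.
rewrite /horizontal_components -components_himage himageI image_bigcup.
congr (components (_ `&` _)); apply: eq_bigcup => // j _.
by rewrite -(symmetry_preimage_iter 1).
Qed.

Lemma vertical_components_induced N (G : 'I_N -> geom_rectangle S) k :
  vertical_components f (fun i => induced_rectangle h (G i)) k =
  [set h @` C | C in vertical_components f G k].
Proof.
rewrite /vertical_components -components_himage himageI image_bigcup.
congr (components (_ `&` _)); apply: eq_bigcup => // j _.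
by rewrite -(symmetry_image_iter 1).
Qed.

(** The numbers of subrectangles, [rho] and [eps] are kept as witnesses, so the dependent record [T]
    is literally the same; only the subrectangles are moved by [h]. *)
Lemma is_geometric_type_induced N (G : 'I_N -> geom_rectangle S) T :
  is_geometric_type A F f G T ->
  is_geometric_type A F f (fun i => induced_rectangle h (G i)) T.
Proof.
move=> [hn [vn [rho [eps [H [V [-> HG VG Hrho Heps]]]]]]].
exists hn, vn, rho, eps, (fun i j => h @` H i j), (fun k l => h @` V k l).
split=> //.
- move=> i; rewrite horizontal_components_induced.
  by apply: increasing_enumeration_himage (HG i) => x y; rewrite vert_induced.
- move=> k; rewrite vertical_components_induced.
  by apply: increasing_enumeration_himage (VG k) => x y; exact: horiz_induced.
- move=> a b; rewrite Hrho !closure_himage -(symmetry_image_iter 1) /=.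
  by split=> [->//|/himage_inj].
(* As [h] carries the vertical orders of [G] to the induced ones and commutes with f, preserving the
   vertical direction means the same for [G] and for its image. Each sign needs one of the two
   implications. *)
- move=> a /=; have [pos neg] := Heps a; split.
  + move=> pres; apply: pos => x y Hx Hy xy.
    rewrite -vert_induced !hf.
    by apply: pres; [exists x|exists y|exists x, y].
  + move=> npres; apply: neg => pres; apply: npres => _ _ [x Hx <-] [y Hy <-].
    move=> [x' [y' [/hfun_inj -> /hfun_inj -> xy]]]; rewrite -!hf.
    by exists (f x), (f y); split=> //; exact: pres.
Qed.

End Transport.

Lemma induced_rectangleK h :
  cancel (induced_rectangle h) (induced_rectangle (hinverse h)).
Proof.
move=> [r lt]; rewrite /induced_rectangle /= hinv_imageK; congr GeomRectangle.
apply/funext => x; apply/funext => y; apply/propext; split.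
  by move=> [_ [_ [<- <- [a [b [<- <- ab]]]]]]; rewrite !hfunK.
by move=> xy; exists (h x), (h y); rewrite !hfunK; split=> //; exists x, y.
Qed.

(** [geometric_type] chooses an element of the set of types of the partition, so it is enough that
    both partitions have the same set. The converse inclusion is the transport by the inverse, which
    gives back [G] itself. *)
Lemma geometric_type_induced h N (G : 'I_N -> geom_rectangle S) :
  symmetry h ->
  geometric_type A F f (fun i => induced_rectangle h (G i)) =
  geometric_type A F f G.
Proof.
move=> hsym; rewrite /geometric_type.
suff -> : is_geometric_type A F f (fun i => induced_rectangle h (G i)) =
    is_geometric_type A F f G by [].
apply/seteqP; split=> T; last exact: is_geometric_type_induced.
move/(is_geometric_type_induced (symmetry_hinverse hsym)).
suff -> : (fun i => induced_rectangle (hinverse h) (induced_rectangle h (G i))) = G.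
  by [].
by apply/funext => i; exact: induced_rectangleK.
Qed.

End Symmetries.

(** * A pseudo-Anosov map is a symmetry of itself *)

Section PseudoAnosov.
Variables (R : realType) (S : topologicalType) (A : set (chart R S)).
Variables (F : foliations R S) (f : homeomorphism S) (Sing : set S).

Lemma open_open_square : open (@open_square R).
Proof.
rewrite (_ : open_square (R := R) = fst @^-1` `]0, 1[ `&` snd @^-1` `]0, 1[).
  apply: openI; apply: open_comp => [t _|]; try exact: interval_open.
    exact: cvg_fst.
  exact: cvg_snd.
by apply/seteqP; split=> -[a b]; rewrite /open_square /= !in_itv.
Qed.

Lemma chart_continuous (c : chart R S) x :
  is_chart c -> dom c x -> {for x, continuous (Defs.coord c)}.
Proof.
move=> [[oc _] _ cc _] cx; apply: within_continuous_at cc.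
exact: open_nbhs_nbhs.
Qed.

Lemma parametrization_continuous r (rho : R * R -> S) :
  parametrization A F r rho -> {in open_square (R := R), continuous rho}.
Proof.
move=> [[rc _] _ _ _] t; rewrite inE => tsq; apply: within_continuous_at rc.
apply: filterS (open_nbhs_nbhs (conj open_open_square tsq)) => s [].
by move=> /andP[/ltW s0 /ltW s1] /andP[/ltW s2 /ltW s3]; split; apply/andP.
Qed.

Lemma parametrization_inj r (rho : R * R -> S) :
  parametrization A F r rho -> {in open_square (R := R) &, injective rho}.
Proof.
move=> [_ [_ [rho' [rhoK _]]] _ _] s t; rewrite !inE => /rhoK sK /rhoK tK e.
by rewrite -sK e tK.
Qed.

Hypothesis chartA : forall c, A c -> is_chart c.
Hypothesis coverA : forall x, exists2 c, A c & dom c x.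
Hypothesis orient : orientation_preserving A f.

(* f preserves the orientation at every point, so f \o rho preserves it exactly
   when rho does: this covers f^-1 as well. *)
Lemma orientation_preserving_at_transport (rho : R * R -> S) t c d :
  {in open_square (R := R), continuous rho} ->
  {in open_square (R := R) &, injective rho} ->
  open_square t -> A c -> A d -> dom c (rho t) -> dom d (f (rho t)) ->
  orientation_preserving_at (Defs.coord d \o (f \o rho)) t <->
  orientation_preserving_at (Defs.coord c \o rho) t.
Proof.
move=> crho irho tsq Ac Ad ct dt.
have [[oc _] cK _ _] := chartA Ac.
have near_t : \forall s \near t, open_square s /\ dom c (rho s).
  apply: filterI; first exact: (open_nbhs_nbhs (conj open_open_square tsq)).
  have : {for t, continuous rho} by apply: crho; rewrite inE.
  apply; exact: open_nbhs_nbhs.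
(* This is f read in charts, of local degree 1 by [orient]. It relates the two maps only near [t],
   where [rho] stays in the domain of [c]. *)
pose g := Defs.coord d \o f \o icoord c.
have gE : \forall s \near t,
    (g \o (Defs.coord c \o rho)) s = (Defs.coord d \o (f \o rho)) s.
  by apply: filterS near_t => s [_ cs]; rewrite /g /= cK.
have [||gc cg] := @orientation_preserving_at_comp R g (Defs.coord c \o rho) t
  _ _ (orient Ac Ad ct dt).
- apply: filterS near_t => s [ssq cs]; apply: continuous_comp.
    by apply: crho; rewrite inE.
  exact: chart_continuous (chartA Ac) cs.
- apply: filterS near_t => s [ssq cs] /= e; apply: irho; rewrite ?inE //.
  by rewrite -(cK _ cs) e cK.
split=> [op|/cg]; last exact: near_eq_orientation_preserving_at.
apply: gc; apply: near_eq_orientation_preserving_at op.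
by apply: filterS gE => s ->.
Qed.

Lemma pseudo_anosov_symmetry :
  generalized_pseudo_anosov A F f -> is_Sing F f Sing -> symmetry A F f Sing f.
Proof.
move=> [_ [_ leaf_refl leaf_eq _ _] [fprong fleaf] _] [Sing1 Sing0].
have leafE d x y : leaf F d (f x) (f y) <-> leaf F d x y.
  by rewrite -fleaf mem_himage.
split=> //.
(* Without singularities, Sing(f) is invariant by choice; otherwise it is defined by the number of
   prongs, which f preserves. *)
- move=> x; have [sing0|/eqP/set0P/Sing1 ->] := pselect (singularities F = set0).
    by have [_ _ fSing _] := Sing0 sing0; rewrite -[X in X (f x)]fSing mem_himage.
  by rewrite /singularities /= fprong.
- move=> r rho; split=> param; last first.
    apply: (parametrization_himage _ param) => // t d tsq Ad dt.
    have [c Ac ct] := coverA (rho t).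
    apply/(orientation_preserving_at_transport _ _ tsq Ac Ad ct dt).
    + exact: parametrization_continuous param.
    + exact: parametrization_inj param.
    + by case: param => _ _ op _; exact: op.
  (* For the converse, the inverse of f is applied to the parametrization [f \o rho]. *)
  have fK : hinverse f \o (f \o rho) = rho.
    by apply/funext => t /=; rewrite hfunK.
  rewrite -(hinv_imageK f r) -[X in parametrization _ _ _ X]fK.
  apply: (parametrization_himage (h := hinverse f)) => //.
    exact: preserves_leaves_hinverse.
  rewrite fK => t c tsq Ac; rewrite /= hfunK => ct.
  (* The goal concerns the chart [c] at [rho t]; a chart at [f (rho t)] is chosen to use the
     orientation clause known for [f \o rho]. *)
  have [d Ad dt] := coverA (f (rho t)).
  apply/(orientation_preserving_at_transport _ _ tsq Ac Ad ct dt).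
  + move=> s ssq; rewrite -fK; apply: continuous_comp.
      exact: (parametrization_continuous param).
    exact: hinv_continuous.
  + move=> s u ssq usq e; apply: (parametrization_inj param) => //=.
    by rewrite e.
  + by case: param => _ _ op _; exact: op.
Qed.

End PseudoAnosov.

Theorem corollary6 (R : realType) (S : topologicalType) (A : set (chart R S))
    (hS : closed_oriented_surface A)
    (F : foliations R S) (f : homeomorphism S)
    (hf : generalized_pseudo_anosov A F f)
    (Sing : set S) (hSing : is_Sing F f Sing)
    (z : S) (hz : first_intersection F Sing z)
    (n : nat) (hn : leq (compatibility_order F f Sing A) n)
    (N : nat) (G : 'I_N -> geom_rectangle S)
    (hG : geom_primitive_partition F f Sing A z n G)
    (m : int) :
  let G' := fun i => induced_rectangle (hpow f m) (G i) in
  [/\ first_intersection F Sing (hpow f m z),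
      geom_primitive_partition F f Sing A (hpow f m z) n G'
    & geometric_type A F f G = geometric_type A F f G'].
Proof.
move=> G'; rewrite {}/G'.
have [_ chartA coverA _] := hS; have [orient _ _ _] := hf.
have fsym := pseudo_anosov_symmetry chartA coverA orient hf hSing.
(* Symmetries form a group containing f, hence all its integer powers. *)
have [h hsym ->] : exists2 h, symmetry A F f Sing h & hpow f m = h.
  apply: hpow_closed => //; first exact: symmetry_hid.
    exact: symmetry_hinverse.
  by move=> k l; exact: symmetry_hcomp.
split.
- exact: first_intersection_himage hsym _ hz.
- exact: geom_primitive_partition_induced hsym _ _ _ _ hG.
- by rewrite (geometric_type_induced _ hsym).
Qed.
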